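(* For each integer $n\geq 1$, the tree language $\mathcal{L}_n\subseteq T^\omega_{\{0,1\}}$ is $D_{\omega^n}(\boldsymbol{\Sigma}^1_1)$-complete, and it is accepted by a (nondeterministic) Muller tree automaton.
   Context: **Trees.** For a finite alphabet $\Sigma$, $T_\Sigma^\omega$ is the set of all functions $t:\{l,r\}^\star\to\Sigma$ (infinite binary trees labelled in $\Sigma$; nodes are finite words over $\{l,r\}$, the root is the empty word $\lambda$). For $t\in T_\Sigma^\omega$ and $u\in\{l,r\}^\star$, $t_u\in T_\Sigma^\omega$ is the subtree $t_u(v)=t(u\cdot v)$. A path of $t$ is an infinite sequence $t(u_0)t(u_1)t(u_2)\cdots$ of labels along an infinite branch, where $u_0=\lambda$ and $u_{i+1}\in\{u_i l,u_i r\}$ for all $i$. **Topology.** $\Sigma^\omega$ (infinite words) and $T_\Sigma^\omega$ carry the Cantor (product of discrete) topology. $\boldsymbol{\Sigma}^1_1$ is the class of analytic sets. **Difference hierarchy.** A countable ordinal is even if it is of the form $\gamma+m$ with $\gamma$ equal to $0$ or a limit ordinal and $m$ an even non-negative integer; otherwise it is odd. For an ordinal $\eta<\omega_1$ and an increasing sequence $(A_\theta)_{\theta<\eta}$ of subsets of a space $X$, $D_\eta[(A_\theta)_{\theta<\eta}]$ is the set of $x\in X$ such that $x\in A_\theta\setminus\bigcup_{\theta'<\theta}A_{\theta'}$ for some $\theta<\eta$ whose parity is opposite to that of $\eta$. For $X=\Sigma^\omega$ or $X=T_\Sigma^\omega$, $D_\eta(\boldsymbol{\Sigma}^1_1)$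 is the class of all sets $D_\eta[(A_\theta)_{\theta<\eta}]$ with every $A_\theta\subseteq X$ in $\boldsymbol{\Sigma}^1_1$. **Reducibility and completeness.** $E\leq_W F$ (Wadge reducibility) means $E=f^{-1}(F)$ for some continuous function $f$ between the ambient spaces. A set $F$ (in a space $\Sigma^\omega$ or $T_\Sigma^\omega$) is $D_\eta(\boldsymbol{\Sigma}^1_1)$-complete if for every finite alphabet $Y$ and every $E\subseteq Y^\omega$: $E\in D_\eta(\boldsymbol{\Sigma}^1_1)$ iff $E\leq_W F$. **The language $\mathcal{L}$.** $\mathcal{L}\subseteq T^\omega_{\{0,1\}}$ is the set of trees having at least one path in $(0^\star\cdot 1)^\omega$, i.e. at least one path containing infinitely many letters $1$. **The languages $\mathcal{L}_n$.** For non-negative integers $a_{n-1},\ldots,a_0$ write $\mathrm{Ord}(a_{n-1},\ldots,a_0)=\omega^{n-1}\cdot a_{n-1}+\cdots+\omega\cdot a_1+a_0$. For $n=1$, $$\mathcal{L}_1=\{t\in T^\omega_{\{0,1\}}\mid \exists m\geq 0\ \ t_{l^m\cdot r}\in\mathcal{L}\text{ and }\min\{m\geq 0\mid t_{l^m\cdot r}\in\mathcal{L}\}\text{ is odd}\}.$$ For $n\geq 2$, $\mathcal{L}_n$ is the set of $t\in T^\omega_{\{0,1\}}$ for which there exist integers $a_{n-1},\ldots,a_0\geq 0$ such that: (1) $t_{l^{a_{n-1}}\cdot r\cdot l^{a_{n-2}}\cdot r\cdots l^{a_0}\cdot r}\in\mathcal{L}$ and $\mathrm{Ord}(a_{n-1},\ldots,a_0)$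 is odd; (2) for all integers $b_{n-1},\ldots,b_0\ge 0$ with $\mathrm{Ord}(b_{n-1},\ldots,b_0)<\mathrm{Ord}(a_{n-1},\ldots,a_0)$, the tree $t_{l^{b_{n-1}}\cdot r\cdot l^{b_{n-2}}\cdot r\cdots l^{b_0}\cdot r}$ is not in $\mathcal{L}$. **Muller tree automata.** A Muller tree automaton is a tuple $\mathcal{A}=(K,\Sigma,\Delta,q_0,\mathcal{F})$ with $K$ a finite set of states, $\Sigma$ a finite alphabet, $\Delta\subseteq K\times\Sigma\times K\times K$, $q_0\in K$, $\mathcal{F}\subseteq 2^K$. A run on $t\in T_\Sigma^\omega$ is a tree $\rho\in T_K^\omega$ with $\rho(\lambda)=q_0$ and $(\rho(u),t(u),\rho(u\cdot l),\rho(u\cdot r))\in\Delta$ for all $u\in\{l,r\}^\star$. It is accepting if for each path of $\rho$ the set of states appearing infinitely often on the path belongs to $\mathcal{F}$. $\mathcal{A}$ accepts the language of all trees $t$ on which it has at least one accepting run. *)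

(* Defs.v *)
From Stdlib Require Import Wellfounded.
From HB Require Import structures.
From mathcomp Require Import all_boot all_classical topology.

Set Implicit Arguments.
Unset Strict Implicit.
Unset Printing Implicit Defensive.

Local Open Scope classical_set_scope.
Local Open Scope nat_scope.

(** * Ordinals *)

(* An ordinal is represented by any well-ordered type having it as order type;
   equality of ordinals is [wo_iso], and the ordinals smaller than [o] are
   represented by the elements [x : o], via the initial segments [wo_seg x]. *)
Record wellorder : Type := Wellorder {
  wo_sort :> Type;
  wo_lt : wo_sort -> wo_sort -> Prop;
  wo_trans : forall x y z, wo_lt x y -> wo_lt y z -> wo_lt x z;
  wo_total : forall x y, [\/ wo_lt x y, x = y | wo_lt y x];
  wo_wf : well_founded wo_lt
}.
Arguments wo_lt {w} x y.

Definition wo_iso (o1 o2 : wellorder) : Prop :=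
  exists f : o1 -> o2,
    bijective f /\ forall x y, wo_lt x y <-> wo_lt (f x) (f y).

Section Seg.
Variables (o : wellorder) (x : o).

Definition seg_lt (y z : {y : o | wo_lt y x}) : Prop :=
  wo_lt (sval y) (sval z).

Lemma seg_trans y1 y2 y3 : seg_lt y1 y2 -> seg_lt y2 y3 -> seg_lt y1 y3.
Proof. exact: wo_trans. Qed.

Lemma seg_total y z : [\/ seg_lt y z, y = z | seg_lt z y].
Proof.
case: y z => [y yx] [z zx]; rewrite /seg_lt /=.
case: (wo_total y z) => h; [by constructor 1| |by constructor 3].
by constructor 2; exact: eq_exist.
Qed.

Lemma seg_wf : well_founded seg_lt.
Proof. exact: (wf_inverse_image _ _ _ _ (@wo_wf o)). Qed.

Definition wo_seg : wellorder := Wellorder seg_trans seg_total seg_wf.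
End Seg.

Definition ord_lt (o1 o2 : wellorder) : Prop :=
  exists x : o2, wo_iso o1 (wo_seg x).

Definition nat_lt (m n : nat) : Prop := m < n.

Lemma nat_lt_trans m n p : nat_lt m n -> nat_lt n p -> nat_lt m p.
Proof. exact: ltn_trans. Qed.

Lemma nat_lt_total m n : [\/ nat_lt m n, m = n | nat_lt n m].
Proof.
by rewrite /nat_lt; case: (ltngtP m n) => h;
  [constructor 1|constructor 3|constructor 2].
Qed.

Lemma nat_lt_wf : well_founded nat_lt.
Proof.
move=> n; elim: n {-2}n (leqnn n) => [|n IH] m hm.
  by constructor => k; rewrite /nat_lt; move: hm; rewrite leqn0 => /eqP ->.
by constructor => k hk; apply: IH; rewrite -ltnS; apply: leq_trans hm.
Qed.

Definition wo_omega : wellorder :=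
  Wellorder nat_lt_trans nat_lt_total nat_lt_wf.

Definition wo_nat (k : nat) : wellorder := @wo_seg wo_omega k.

Section Sum.
Variables o1 o2 : wellorder.

Definition sum_lt (u v : o1 + o2) : Prop :=
  match u, v with
  | inl x, inl y => wo_lt x y
  | inl _, inr _ => True
  | inr _, inl _ => False
  | inr x, inr y => wo_lt x y
  end.

Lemma sum_trans u v w : sum_lt u v -> sum_lt v w -> sum_lt u w.
Proof. by case: u v w => x [] y [] z //=; exact: wo_trans. Qed.

Lemma sum_total u v : [\/ sum_lt u v, u = v | sum_lt v u].
Proof.
case: u v => x [] y /=; try by [constructor 1|constructor 3].
- case: (wo_total x y) => h; [by constructor 1| |by constructor 3].
  by constructor 2; rewrite h.
- case: (wo_total x y) => h; [by constructor 1| |by constructor 3].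
  by constructor 2; rewrite h.
Qed.

Lemma sum_wf : well_founded sum_lt.
Proof.
have acc1 x : Acc sum_lt (inl x).
  by elim: (wo_wf x) => {}x _ IH; apply: Acc_intro => -[y /IH|].
case=> [|x]; first exact: acc1.
elim: (wo_wf x) => {}x _ IH; apply: Acc_intro => -[y _|y yx].
  exact: acc1.
exact: IH.
Qed.

Definition wo_sum : wellorder := Wellorder sum_trans sum_total sum_wf.
End Sum.

(* [wo_mul o1 o2] is the ordinal product o1 . o2, i.e. o2 copies of o1 put one
   after the other: the [o2] component is the most significant one. *)
Section Mul.
Variables o1 o2 : wellorder.

Definition mul_lt (u v : o2 * o1) : Prop :=
  wo_lt u.1 v.1 \/ (u.1 = v.1 /\ wo_lt u.2 v.2).

Lemma mul_trans u v w : mul_lt u v -> mul_lt v w -> mul_lt u w.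
Proof.
case: u v w => [x1 x2] [y1 y2] [z1 z2]; rewrite /mul_lt /=.
case=> [h|[-> h]] [h'|[<- h']]; first by left; exact: wo_trans h h'.
- by left.
- by left.
- by right; split=> //; exact: wo_trans h h'.
Qed.

Lemma mul_total u v : [\/ mul_lt u v, u = v | mul_lt v u].
Proof.
case: u v => [x1 x2] [y1 y2]; rewrite /mul_lt /=.
case: (wo_total x1 y1) => [h|<-|h]; [by constructor 1; left| |
  by constructor 3; left].
case: (wo_total x2 y2) => [h|<-|h]; [by constructor 1; right|
  by constructor 2|by constructor 3; right].
Qed.

Lemma mul_wf : well_founded mul_lt.
Proof.
case=> x y; elim: (wo_wf x) y => {}x _ IHx y.
elim: (wo_wf y) => {}y _ IHy.
by apply: Acc_intro => -[x' y'] [/= h|[/= -> h]]; [exact: IHx|exact: IHy].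
Qed.

Definition wo_mul : wellorder := Wellorder mul_trans mul_total mul_wf.
End Mul.

Fixpoint wo_exp (o : wellorder) (k : nat) : wellorder :=
  if k is k'.+1 then wo_mul (wo_exp o k') o else wo_nat 1.

(* [Ord [:: a_(n-1); ...; a_0]] is omega^(n-1) . a_(n-1) + ... + a_0. *)
Fixpoint Ord (a : seq nat) : wellorder :=
  if a is k :: a' then
    wo_sum (wo_mul (wo_exp wo_omega (size a')) (wo_nat k)) (Ord a')
  else wo_nat 0.

Definition wo_zero (o : wellorder) : Prop := ~ inhabited o.

Definition wo_limit (o : wellorder) : Prop :=
  inhabited o /\ forall x : o, exists y : o, wo_lt x y.

Definition wo_even (o : wellorder) : Prop :=
  exists (g : wellorder) (m : nat),
    [/\ wo_zero g \/ wo_limit g, ~~ odd m & wo_iso o (wo_sum g (wo_nat m))].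

Definition wo_odd (o : wellorder) : Prop := ~ wo_even o.

Definition opposite_parity (o1 o2 : wellorder) : Prop :=
  (wo_odd o1 /\ wo_even o2) \/ (wo_even o1 /\ wo_odd o2).

(** * Words and trees over a finite alphabet *)

Definition word (S : finType) : Type :=
  prod_topology (fun _ : nat => discrete_topology S).
HB.instance Definition _ (S : finType) := Topological.on (word S).

(* The directions l and r are [false] and [true]; a node is a [seq bool]. *)
Notation dir_l := false (only parsing).
Notation dir_r := true (only parsing).

Definition tree (S : finType) : Type :=
  prod_topology (fun _ : seq bool => discrete_topology S).
HB.instance Definition _ (S : finType) := Topological.on (tree S).

Definition subtree (S : finType) (t : tree S) (u : seq bool) : tree S :=
  fun v => t (u ++ v).

Definition is_branch (u : nat -> seq bool) : Prop :=
  u 0 = [::] /\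
  forall i, u i.+1 = rcons (u i) dir_l \/ u i.+1 = rcons (u i) dir_r.

Definition is_path (S : finType) (t : tree S) (p : nat -> S) : Prop :=
  exists u, is_branch u /\ forall i, p i = t (u i).

Definition infinitely_often (S : Type) (p : nat -> S) (s : S) : Prop :=
  forall N, exists2 i, N <= i & p i = s.

(** * Analytic sets, the difference hierarchy, Wadge reducibility *)

Definition baire : Type :=
  prod_topology (fun _ : nat => discrete_topology nat).
HB.instance Definition _ := Topological.on baire.

(* Sigma^1_1: projections along the Baire space of closed sets. *)
Definition analytic (X : topologicalType) (A : set X) : Prop :=
  exists2 C : set (X * baire), closed C & A = [set x | exists y, C (x, y)].

Section Differences.
Variables (X : topologicalType) (o : wellorder).

Definition increasing_family (A : o -> set X) : Prop :=
  forall i j : o, wo_lt i j -> A i `<=` A j.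

Definition difference (A : o -> set X) : set X :=
  [set x | exists i : o,
    [/\ A i x, forall j : o, wo_lt j i -> ~ A j x &
        opposite_parity (wo_seg i) o]].

Definition D_analytic (E : set X) : Prop :=
  exists A : o -> set X,
    [/\ increasing_family A, forall i, analytic (A i) & E = difference A].
End Differences.

Definition wadge_le (X Y : topologicalType) (E : set X) (F : set Y) : Prop :=
  exists2 f : X -> Y, continuous f & E = f @^-1` F.

Definition D_analytic_complete (o : wellorder) (X : topologicalType)
    (F : set X) : Prop :=
  forall (Y : finType) (E : set (word Y)), D_analytic o E <-> wadge_le E F.

(** * The tree languages; the alphabet {0, 1} is [bool], 1 being [true] *)

Definition langL : set (tree bool) :=
  [set t | exists2 p, is_path t p & infinitely_often p true].

(* l^(a_(n-1)) . r ... l^(a_0) . r *)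
Definition address (a : seq nat) : seq bool :=
  flatten [seq nseq k dir_l ++ [:: dir_r] | k <- a].

Definition langL_one : set (tree bool) :=
  [set t | exists m,
    [/\ langL (subtree t (address [:: m])),
        forall k, langL (subtree t (address [:: k])) -> m <= k & odd m]].

Definition langL_many (n : nat) : set (tree bool) :=
  [set t | exists a : n.-tuple nat,
    [/\ langL (subtree t (address a)), wo_odd (Ord a) &
        forall b : n.-tuple nat, ord_lt (Ord b) (Ord a) ->
          ~ langL (subtree t (address b))]].

Definition langL_ (n : nat) : set (tree bool) :=
  if n == 1 then langL_one else langL_many n.

(** * Muller tree automata *)

Record muller_automaton (S : finType) : Type := MullerAutomaton {
  mstate : finType;
  mtrans : {set mstate * S * mstate * mstate};
  minit : mstate;
  mtable : {set {set mstate}}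
}.

Section Muller.
Variables (S : finType) (M : muller_automaton S).

Definition is_run (t : tree S) (rho : tree (mstate M)) : Prop :=
  rho [::] = minit M /\
  forall u : seq bool,
    (rho u, t u, rho (rcons u dir_l), rho (rcons u dir_r)) \in mtrans M.

Definition inf_states (p : nat -> mstate M) : {set mstate M} :=
  finset (fun q => `[< infinitely_often p q >]).

Definition accepting (rho : tree (mstate M)) : Prop :=
  forall p, is_path rho p -> inf_states p \in mtable M.

Definition accepted_language : set (tree S) :=
  [set t | exists2 rho, is_run t rho & accepting rho].
End Muller.

(* Main.v *)
(* Hardness: if A is the projection of a closed set C, label the node
   l^(y_0) r ... l^(y_(k-1)) r by 1 when the length-k neighbourhood of (x, y)
   meets C; a path with infinitely many 1's then spells some y with (x, y) in C,
   so A reduces to L.  Putting such a tree for A_theta below the address of each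
   theta < omega^n reduces D_(omega^n)[(A_theta)] to L_n, since omega^n is even
   and the least theta with x in A_theta has to be odd.  Conversely, L_n is the
   difference of the sets "some subtree at an address <= theta is in L", which
   are countable unions of continuous preimages of the analytic set L.

   Automaton: guess the least address a in the lexicographic order along the
   spine of l's.  The parity of Ord(a) is that of a_0, so one bit per block of
   l's suffices; below a, guess a path with infinitely many 1's; at every
   smaller address check that no path has infinitely many 1's, which is a Muller
   condition on a deterministic run. *)
Require Import Defs.
From HB Require Import structures.
From mathcomp Require Import all_boot all_classical topology.

Set Implicit Arguments.
Unset Strict Implicit.
Unset Printing Implicit Defensive.

Local Open Scope classical_set_scope.
Local Open Scope nat_scope.

(** * Ordinals below omega^n *)

Lemma wo_irr (o : wellorder) (x : o) : ~ wo_lt x x.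
Proof. by elim: (wo_wf x) => {}x _ IH xx; exact: (IH x). Qed.

Lemma wo_asym (o : wellorder) (x y : o) : wo_lt x y -> ~ wo_lt y x.
Proof. by move=> xy yx; apply: (@wo_irr o x); exact: wo_trans yx. Qed.

(** Totality makes a strictly monotone map injective and order-reflecting, so surjectivity is all
    that remains to be checked for an isomorphism. *)
Lemma wo_iso_surj (o1 o2 : wellorder) (f : o1 -> o2) :
  (forall x y, wo_lt x y -> wo_lt (f x) (f y)) ->
  (forall y, exists x, f x = y) -> wo_iso o1 o2.
Proof.
move=> mf sf; have [g fg] := choice sf.
have lf x y : wo_lt x y <-> wo_lt (f x) (f y).
  split; first exact: mf.
  case: (wo_total x y) => [//|-> /wo_irr //|/mf yx xy].
  by case: (wo_asym yx).
exists f; split=> //; exists g => // x.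
case: (wo_total (g (f x)) x) => // /mf; rewrite fg => /wo_irr //.
Qed.

Lemma wo_iso_sym (o1 o2 : wellorder) : wo_iso o1 o2 -> wo_iso o2 o1.
Proof.
case=> f [[g fg gf] lf]; apply: (@wo_iso_surj _ _ g) => [x y|y].
  by rewrite -{1}(gf x) -{1}(gf y) => /lf.
by exists (f y).
Qed.

Lemma wo_iso_trans (o1 o2 o3 : wellorder) :
  wo_iso o1 o2 -> wo_iso o2 o3 -> wo_iso o1 o3.
Proof.
case=> f [bf lf] [g [bg lg]]; exists (g \o f); split; first exact: bij_comp.
by move=> x y; rewrite lf lg.
Qed.

Lemma wo_even_iso (o1 o2 : wellorder) :
  wo_iso o1 o2 -> wo_even o1 <-> wo_even o2.
Proof.
have imp p1 p2 : wo_iso p1 p2 -> wo_even p1 -> wo_even p2.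
  move=> i [g [m [gl om i']]]; exists g, m; split=> //.
  exact: wo_iso_trans (wo_iso_sym i) i'.
by move=> i; split; apply: imp => //; exact: wo_iso_sym.
Qed.

Lemma wo_sum_isor (o o1 o2 : wellorder) :
  wo_iso o1 o2 -> wo_iso (wo_sum o o1) (wo_sum o o2).
Proof.
case=> f [[g fg gf] lf].
apply: (@wo_iso_surj (wo_sum o o1) (wo_sum o o2)
  (fun u => match u with inl x => inl x | inr y => inr (f y) end)).
  by move=> [x|x] [y|y] //= /lf.
by case=> [x|y]; [exists (inl x)|exists (inr (g y)); rewrite gf].
Qed.

Lemma wo_sumA (o1 o2 o3 : wellorder) :
  wo_iso (wo_sum o1 (wo_sum o2 o3)) (wo_sum (wo_sum o1 o2) o3).
Proof.
apply: (@wo_iso_surj (wo_sum o1 (wo_sum o2 o3)) (wo_sum (wo_sum o1 o2) o3)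
  (fun u => match u with
   | inl x => inl (inl x) | inr (inl x) => inl (inr x) | inr (inr x) => inr x
   end)).
  by move=> [x|[x|x]] [y|[y|y]].
by move=> [[x|x]|x]; [exists (inl x)|exists (inr (inl x))|exists (inr (inr x))].
Qed.

Lemma wo_sum0 (o z : wellorder) : wo_zero z -> wo_iso o (wo_sum o z).
Proof.
move=> z0; apply: (@wo_iso_surj o (wo_sum o z) inl) => //.
by case=> [x|x]; [exists x|case: z0].
Qed.

Lemma wo_nat0 : wo_zero (wo_nat 0).
Proof. by case=> -[]. Qed.

(** A pair below [x] either has a smaller leading component, with an arbitrary second one, or shares
    the leading component and is smaller in the second. *)
Lemma wo_seg_mul (o1 o2 : wellorder) (x : wo_mul o1 o2) :
  wo_iso (wo_sum (wo_mul o1 (wo_seg x.1)) (wo_seg x.2)) (wo_seg x).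
Proof.
pose f (u : wo_sum (wo_mul o1 (wo_seg x.1)) (wo_seg x.2)) : wo_seg x :=
  match u with
  | inl (exist y2 h, y1) =>
      exist (fun y : wo_mul o1 o2 => wo_lt y x) (y2, y1) (or_introl h)
  | inr (exist y1 h) =>
      exist (fun y : wo_mul o1 o2 => wo_lt y x) (x.1, y1)
        (or_intror (conj erefl h))
  end.
apply: (@wo_iso_surj _ _ f).
  move=> [[[y2 hy] y1]|[y1 hy]] [[[z2 hz] z1]|[z1 hz]] //=.
  - case=> [|[[/= yz]]] /= h; first by left.
    by right; split.
  - by move=> _; left.
  - by move=> h; right; split.
case=> -[y2 y1] [h|[h1 h2]].
  by exists (inl (exist _ y2 h, y1)); apply: eq_exist.
exists (inr (exist _ y1 h2)); apply: eq_exist.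
by rewrite -h1.
Qed.

(** If [f x] were below [x], monotonicity would put [f (f x)] below [f x], and so on: an infinite
    descent. *)
Lemma wo_mono_inflationary (o : wellorder) (f : o -> o) :
  (forall x y, wo_lt x y -> wo_lt (f x) (f y)) -> forall x, ~ wo_lt (f x) x.
Proof.
move=> mf x; elim: (wo_wf x) => {}x _ IH fx.
exact: (IH (f x) fx (mf _ _ fx)).
Qed.

Lemma wo_seg_inj (o : wellorder) (x y : o) :
  wo_iso (wo_seg x) (wo_seg y) -> x = y.
Proof.
have no (a b : o) : wo_lt a b -> ~ wo_iso (wo_seg b) (wo_seg a).
  move=> ab [f [_ lf]].
  (* The isomorphism onto the shorter segment, followed by inclusion, is a strictly monotone
     self-map of [wo_seg b] that moves [a] down. *)
  pose g (u : wo_seg b) : wo_seg b :=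
    exist (fun y : o => wo_lt y b) (sval (f u)) (wo_trans (svalP (f u)) ab).
  have mg u v : wo_lt u v -> wo_lt (g u) (g v) by move/lf.
  apply: (wo_mono_inflationary mg (x := exist (fun y : o => wo_lt y b) a ab)).
  exact: (svalP (f _)).
move=> i; case: (wo_total x y) => // h; last by case: (no _ _ h i).
by case: (no _ _ h (wo_iso_sym i)).
Qed.

(** Turns comparison of ordinals up to isomorphism into comparison inside one well-order. Both
    directions carry an initial segment across [f]; non-isomorphism of distinct segments then
    identifies its endpoint. *)
Lemma ord_lt_seg (o o1 o2 : wellorder) (x y : o) :
  wo_iso o1 (wo_seg x) -> wo_iso o2 (wo_seg y) ->
  ord_lt o1 o2 <-> wo_lt x y.
Proof.
move=> i1 [f [[g fg gf] lf]]; split.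
  case=> z i2; suff -> : x = sval (f z) by exact: (svalP (f z)).
  apply: wo_seg_inj; apply: wo_iso_trans (wo_iso_sym i1) _.
  apply: wo_iso_trans i2 _.
  apply: (@wo_iso_surj (wo_seg z) (wo_seg (sval (f z)))
    (fun u => exist (fun v : o => wo_lt v (sval (f z))) (sval (f (sval u)))
      (proj1 (lf _ _) (svalP u)))).
    by move=> [u hu] [v hv] /lf.
  case=> v hv; pose v' : wo_seg y := exist _ v (wo_trans hv (svalP (f z))).
  have hv' : wo_lt (g v') z by rewrite lf gf.
  by exists (exist _ (g v') hv'); apply: eq_exist => /=; rewrite gf.
move=> xy; pose x' : wo_seg y := exist _ x xy.
exists (g x'); apply: wo_iso_trans i1 _; apply: wo_iso_sym.
have lgx u : wo_lt u (g x') -> wo_lt (sval (f u)) x by move/lf; rewrite gf.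
apply: (@wo_iso_surj (wo_seg (g x')) (wo_seg x)
  (fun u => exist (fun v : o => wo_lt v x) (sval (f (sval u)))
     (lgx _ (svalP u)))).
  by move=> [u hu] [v hv] /lf.
case=> v hv; pose v' : wo_seg y := exist _ v (wo_trans hv xy).
have hv' : wo_lt (g v') (g x') by rewrite lf !gf.
by exists (exist _ (g v') hv'); apply: eq_exist => /=; rewrite gf.
Qed.

(** Coefficients are listed from the most significant one. Short lists are padded with 0 and long
    ones cut, hence the condition [size s = n] in [eltK]. *)
Fixpoint elt (n : nat) (s : seq nat) : wo_exp wo_omega n :=
  if n is n'.+1 return wo_exp wo_omega n then (head 0 s, elt n' (behead s))
  else exist _ 0 (ltn0Sn 0).

Fixpoint coords (n : nat) : wo_exp wo_omega n -> seq nat :=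
  if n is n'.+1 return wo_exp wo_omega n -> seq nat
  then fun x => x.1 :: coords x.2 else fun=> [::].

Lemma size_coords n (x : wo_exp wo_omega n) : size (coords x) = n.
Proof. by elim: n x => //= n IH [k x] /=; rewrite IH. Qed.

Lemma coordsK n : cancel (@coords n) (elt n).
Proof.
elim: n => [[k hk]|n IH [k x]] /=; last by rewrite IH.
by apply: eq_exist => /=; move: hk; rewrite /nat_lt; case: k.
Qed.

Lemma eltK n s : size s = n -> coords (elt n s) = s.
Proof. by elim: n s => [|n IH] [|k s] //= [/IH ->]. Qed.

Lemma Ord_elt (s : seq nat) : wo_iso (Ord s) (wo_seg (elt (size s) s)).
Proof.
elim: s => [|k s IH] /=.
  by apply: (@wo_iso_surj _ _ (fun u => False_rect _ (wo_nat0 (inhabits u))))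
    => -[y hy].
have := @wo_seg_mul (wo_exp wo_omega (size s)) wo_omega (k, elt (size s) s).
by apply: wo_iso_trans; exact: wo_sum_isor.
Qed.

(** * Parity of the ordinals below omega^n *)

Definition zero_limit (o : wellorder) := wo_zero o \/ wo_limit o.

Lemma zero_limit_nomax (o : wellorder) :
  zero_limit o <-> forall x : o, exists y : o, wo_lt x y.
Proof.
split=> [[z x|[]//]|h]; first by case: z.
by case: (pselect (inhabited o)) => i; [right|left].
Qed.

Lemma zero_limit_sum (o1 o2 : wellorder) :
  zero_limit o1 -> zero_limit o2 -> zero_limit (wo_sum o1 o2).
Proof.
rewrite !zero_limit_nomax => l1 l2 [x|x].
  by have [y] := l1 x; exists (inl y).
by have [y] := l2 x; exists (inr y).
Qed.

Lemma zero_limit_mulr (o1 o2 : wellorder) :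
  zero_limit o1 -> zero_limit (wo_mul o1 o2).
Proof.
rewrite !zero_limit_nomax => l1 [x2 x1]; have [y xy] := l1 x1.
by exists (x2, y); right.
Qed.

Lemma zero_limit_exp n : 0 < n -> zero_limit (wo_exp wo_omega n).
Proof.
case: n => // n _; apply/zero_limit_nomax => -[k x].
by exists (k.+1, x); left; rewrite /= /nat_lt.
Qed.

Lemma wo_even_zero_limit o : zero_limit o -> wo_even o.
Proof.
by move=> lo; exists o, 0; split=> //; apply: wo_sum0; exact: wo_nat0.
Qed.

(** Every term but the last is a multiple of a positive power of omega and so has no greatest
    element; the last coefficient is the finite part. *)
Lemma Ord_rcons (s : seq nat) (k : nat) :
  exists2 g, zero_limit g & wo_iso (Ord (rcons s k)) (wo_sum g (wo_nat k)).
Proof.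
elim: s => [|j s [g lg ig]] /=.
  exists (wo_nat 0); first by left; exact: wo_nat0.
  have h1 : nat_lt 0 1 by [].
  apply: wo_iso_trans (wo_iso_sym (wo_sum0 _ wo_nat0)) _.
  apply: (@wo_iso_surj (wo_mul (wo_nat 1) (wo_nat k))
    (wo_sum (wo_nat 0) (wo_nat k))
    (fun u => inr u.1)).
    move=> [x2 [x1 h1x]] [y2 [y1 h1y]] [//|[_] /=]; rewrite /seg_lt /= /nat_lt.
    by move: h1x h1y; rewrite /= /nat_lt; case: x1 y1 => [|?] [|?].
  by case=> [[]//|x]; exists (x, exist _ 0 h1).
exists (wo_sum (wo_mul (wo_exp wo_omega (size s).+1) (wo_nat j)) g).
  apply: zero_limit_sum => //; apply: zero_limit_mulr.
  exact: zero_limit_exp.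
rewrite size_rcons; apply: wo_iso_trans (wo_sumA _ _ _).
exact: wo_sum_isor.
Qed.

(* In g + m with g zero or a limit, exactly m elements lie finitely far from
   the top; this isomorphism invariant makes the parity well defined. *)
Fixpoint from_top (o : wellorder) (k : nat) (x : o) : Prop :=
  if k is k'.+1 then
    exists y, [/\ from_top k' y, wo_lt x y &
                forall z, wo_lt x z -> ~ wo_lt z y]
  else forall z, ~ wo_lt x z.

Lemma from_top_iso (o1 o2 : wellorder) (k : nat) :
  wo_iso o1 o2 -> (exists x : o1, from_top k x) -> exists x : o2, from_top k x.
Proof.
case=> f [[g fg gf] lf] [x hx]; exists (f x).
elim: k x hx => [|k IH] x /=.
  by move=> hx z; rewrite -(gf z) -lf; exact: hx.
case=> y [/IH hy xy h]; exists (f y); split=> //; first by rewrite -lf.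
by move=> z; rewrite -(gf z) -!lf; exact: h.
Qed.

Lemma from_top_sum (g : wellorder) (m k : nat) : zero_limit g ->
  (exists x : wo_sum g (wo_nat m), from_top k x) <-> k < m.
Proof.
move/zero_limit_nomax => lg.
(* Elements at finite distance from the top all lie in the finite part, since [g] has no last
   element; there position and distance determine each other. *)
have H : forall x : wo_sum g (wo_nat m), from_top k x <->
    (if x is inr y then sval y + k.+1 = m else False).
  elim: k => [|k IH] x /=.
    split.
      case: x => [x h|[x hx] h].
        by have [y xy] := lg x; exact: (h (inl y)).
      have := hx; rewrite /= addn1 /nat_lt leq_eqVlt => /orP[/eqP//|hx'].
      by case: (h (inr (exist (fun y => nat_lt y m) x.+1 hx'))); exact: ltnSn.
    case: x => // -[x hx] /= xm [z|[z hz]] //=; rewrite /seg_lt /nat_lt /=.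
    move: hz; rewrite /nat_lt -{1}xm addn1 ltnS => zx xz.
    by move: (leq_trans xz zx); rewrite ltnn.
  split.
    case=> -[y|[y hy]] [/IH]//= ym.
    case: x => [x|[x hx]] xy h.
      by have [z xz] := lg x; case: (h (inl z)).
    move: xy; rewrite /= /seg_lt /= /nat_lt leq_eqVlt => /orP[/eqP xy|xy].
      by rewrite -ym -xy addSnnS.
    case: (h (inr (exist (fun y => nat_lt y m) x.+1 (ltn_trans xy hy)))) => //=.
    exact: ltnSn.
  case: x => // -[x hx] /= xm.
  have hx1 : x.+1 < m by rewrite -xm !addnS !ltnS leq_addr.
  exists (inr (exist (fun y => nat_lt y m) x.+1 hx1)); split.
  - by apply/IH; rewrite /= addSnnS.
  - exact: ltnSn.
  - move=> [z|[z hz]] //=; rewrite /seg_lt /= /nat_lt ltnS => xz zx.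
    by move: (leq_trans xz zx); rewrite ltnn.
split=> [[x /H]|km].
  by case: x => // -[x hx] /= <-; rewrite ltn_addl.
have h : m - k.+1 < m by rewrite ltn_subrL (leq_trans _ km).
exists (inr (exist (fun y => nat_lt y m) _ h)); apply/H => /=.
by rewrite subnK.
Qed.

Lemma sum_nat_inj (g g' : wellorder) (m m' : nat) :
  zero_limit g -> zero_limit g' ->
  wo_iso (wo_sum g (wo_nat m)) (wo_sum g' (wo_nat m')) -> m = m'.
Proof.
move=> lg lg' i.
have E k : (k < m) = (k < m').
  apply/idP/idP => /from_top_sum; [move/(_ _ lg)|move/(_ _ lg')].
    by move/(from_top_iso i)/from_top_sum; apply.
  by move/(from_top_iso (wo_iso_sym i))/from_top_sum; apply.
apply/eqP; rewrite eqn_leq; apply/andP; split; rewrite leqNgt.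
  by rewrite E ltnn.
by rewrite -E ltnn.
Qed.

Lemma wo_even_Ord (s : seq nat) : s <> [::] ->
  wo_even (Ord s) <-> ~~ odd (last 0 s).
Proof.
case/lastP: s => // s k _; rewrite last_rcons.
have [g lg ig] := Ord_rcons s k; split=> [[g' [m [lg' om i']]]|ok].
  suff -> : k = m by [].
  exact: sum_nat_inj lg lg' (wo_iso_trans (wo_iso_sym ig) i').
by exists g, k.
Qed.

Lemma wo_even_seg n (x : wo_exp wo_omega n) : 0 < n ->
  wo_even (wo_seg x) <-> ~~ odd (last 0 (coords x)).
Proof.
move=> n0; rewrite -wo_even_Ord; last first.
  by move=> h; move: (size_coords x) n0; rewrite h => <-.
apply: wo_even_iso; apply: wo_iso_sym.
by have := Ord_elt (coords x); rewrite size_coords coordsK.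
Qed.

Lemma opposite_parity_seg n (x : wo_exp wo_omega n) : 0 < n ->
  opposite_parity (wo_seg x) (wo_exp wo_omega n) <-> odd (last 0 (coords x)).
Proof.
move=> n0; have e := wo_even_zero_limit (zero_limit_exp n0).
have := wo_even_seg x n0; rewrite /opposite_parity /wo_odd.
case: (odd _) => /= -[h1 h2]; split=> //; first by left; split=> // /h1.
by case=> [[/(_ (h2 isT))]|[_ /(_ e)]].
Qed.

Lemma ord_lt_Ord n (a b : seq nat) : size a = n -> size b = n ->
  ord_lt (Ord a) (Ord b) <-> wo_lt (elt n a) (elt n b).
Proof.
move=> sa sb; apply: ord_lt_seg; [rewrite -sa|rewrite -sb]; exact: Ord_elt.
Qed.

(* [langL_one] and [langL_many] are the same condition once the tuples
   (a_(n-1), ..., a_0) are read as the elements of omega^n. *)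
Lemma langLE n t : 0 < n -> langL_ n t <->
  exists a, [/\ size a = n, langL (subtree t (address a)), odd (last 0 a) &
    forall b, size b = n -> wo_lt (elt n b) (elt n a) ->
      ~ langL (subtree t (address b))].
Proof.
move=> n0; rewrite /langL_; case: eqP => [->|_]; split.
- case=> m [Lm mm om]; exists [:: m]; split=> // -[|k []] //= _.
  by case=> [km /mm|[_ //]]; rewrite leqNgt => /negP.
- case=> a [sa Lm om mm]; case: a sa Lm om mm => [|m []] //= _ Lm om mm.
  exists m; split=> // k Lk.
  by rewrite leqNgt; apply/negP => km; apply: (mm [:: k] _ _ Lk) => //; left.
- case=> a [La oa ma]; exists a; split=> //; first by rewrite size_tuple.
    apply: contrapT => /negP; rewrite -wo_even_Ord //.
    by move=> h; move: n0; rewrite -(size_tuple a) h.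
  move=> b sb ba; have := ma (tcast sb (in_tuple b)).
  by rewrite val_tcast; apply; apply/(ord_lt_Ord sb (size_tuple a)).
- case=> a [sa La oa ma]; exists (tcast sa (in_tuple a)).
  rewrite val_tcast /=; split=> //.
    have nn : a <> [::] by move=> h; move: n0; rewrite -sa h.
    by rewrite /wo_odd wo_even_Ord // oa.
  by move=> b /(ord_lt_Ord (size_tuple b) sa); apply: ma; rewrite size_tuple.
Qed.

(** * Product topologies and analytic sets *)

Section Coordinates.
Variables (I : eqType) (S : choiceType).
Notation power := (prod_topology (fun _ : I => discrete_topology S)).

Lemma near_coord (x : power) (i : I) : \forall y \near x, y i = x i.
Proof.
have := @proj_continuous I (fun=> discrete_topology S) i x.
move/(_ [set x i]); apply; exact: (discrete_set1 (x i : discrete_topology S)).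
Qed.

Lemma cvg_coord (F : set_system power) (x : power) : Filter F ->
  (forall i, \forall y \near F, y i = x i) -> F --> x.
Proof.
move=> FF h; apply/cvg_sup => i A [_ [[B _ <-] /= Bx sBA]].
by apply: filterS (h i) => y yx; apply: sBA; rewrite /= yx.
Qed.

Lemma continuous_coord (X : topologicalType) (f : X -> power) :
  (forall x i, \forall y \near x, f y i = f x i) -> continuous f.
Proof. by move=> h x; apply: cvg_coord => i; exact: h. Qed.

Lemma continuous_near_coord (X : topologicalType) (f : X -> power) :
  continuous f -> forall x i, \forall y \near x, f y i = f x i.
Proof.
move=> cf x i; exact: (cf x [set z | z i = f x i] (near_coord (f x) i)).
Qed.

End Coordinates.

Lemma closed_near (X : topologicalType) (A : set X) :
  (forall x, ~ A x -> \forall y \near x, ~ A y) -> closed A.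
Proof. by rewrite closedE => h x nA; apply: contrapT => /h. Qed.

Lemma near_notin (X : topologicalType) (A : set X) (x : X) :
  closed A -> ~ A x -> \forall y \near x, ~ A y.
Proof. by rewrite closedE => h nA; apply: contrapT => /h. Qed.

Lemma near_fst (X Y : topologicalType) (P : set X) (x : X) (y : Y) :
  (\forall x' \near x, P x') -> \forall z \near (x, y), P z.1.
Proof. exact: cvg_fst. Qed.

Lemma near_snd (X Y : topologicalType) (P : set Y) (x : X) (y : Y) :
  (\forall y' \near y, P y') -> \forall z \near (x, y), P z.2.
Proof. exact: cvg_snd. Qed.

Lemma continuous_pair (X Y Z : topologicalType) (f : X -> Y) (g : X -> Z) :
  continuous f -> continuous g -> continuous (fun x => (f x, g x)).
Proof.
move=> cf cg x P [[A B] /= [/cf fA /cg gB] AB].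
apply: (@filterS2 X (nbhs x) _ (f @^-1` A) (g @^-1` B)) => // y Ay By.
exact: (AB (f y, g y)).
Qed.

Lemma continuous_on_fst (X Y Z : topologicalType) (f : X -> Z) :
  continuous f -> continuous (fun z : X * Y => f z.1).
Proof. by move=> cf [x y] P /cf; exact: near_fst. Qed.

Lemma continuous_on_snd (X Y Z : topologicalType) (f : Y -> Z) :
  continuous f -> continuous (fun z : X * Y => f z.2).
Proof. by move=> cf [x y] P /cf; exact: near_snd. Qed.

Lemma analytic_preimage (X Y : topologicalType) (f : X -> Y) (A : set Y) :
  continuous f -> analytic A -> analytic (f @^-1` A).
Proof.
move=> cf [C cC ->]; exists [set z | C (f z.1, z.2)] => //.
have cg := continuous_pair (continuous_on_fst cf)
  (continuous_on_snd (f := id) (fun x : baire => @cvg_id _ _)).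
exact: (proj1 (continuous_closedP _) cg _ cC).
Qed.

Lemma analytic_set0 (X : topologicalType) : analytic (@set0 X).
Proof.
exists set0; first exact: closed0.
by rewrite predeqE => x; split=> // -[].
Qed.

(** The first entry of the witness names the index [k] and its tail witnesses membership in [F k].
    The first entry is locally constant, so closedness can be checked for one [C k] at a time. *)
Lemma analytic_bigcup (X : topologicalType) (F : nat -> set X) :
  (forall k, analytic (F k)) -> analytic [set x | exists k, F k x].
Proof.
move=> aF; have /choice[C HC] k : exists C : set (X * baire),
    closed C /\ F k = [set x | exists y, C (x, y)].
  by have [C] := aF k; exists C.
pose tl (y : baire) : baire := fun i => y i.+1.
have ctl : continuous tl.
  by apply: continuous_coord => y i; exact: (near_coord (y : prod_topology _)).
exists [set z | C (z.2 0) (z.1, tl z.2)].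
  apply: closed_near => -[x y] /= nC.
  have cg := continuous_pair
    (continuous_on_fst (f := id) (fun x : X => @cvg_id _ _))
    (continuous_on_snd ctl).
  have n0 := near_snd x (near_coord (y : prod_topology _) 0).
  apply: filterS2 n0 (cg (x, y) _ (near_notin (HC (y 0)).1 nC)) => z /= ->.
  exact.
rewrite predeqE => x; split=> [[k]|[y Cy]].
  rewrite (HC k).2 => -[y Cy]; exists (fun i => if i is j.+1 then y j else k).
  by rewrite /=; congr (C _ (_, _)): Cy.
by exists (y 0); rewrite (HC _).2; exists (tl y).
Qed.

(** * The automaton *)

(** Recodes a branch as an infinite sequence of directions [d], with [mkseq d i] as its node at
    depth [i]. *)
Lemma is_pathP (S : finType) (t : tree S) (p : nat -> S) :
  is_path t p <-> exists d, p = fun i => t (mkseq d i).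
Proof.
split=> [[u [[u0 uS] pu]]|[d ->]].
  have /choice[d ud] i : exists x, u i.+1 = rcons (u i) x.
    by case: (uS i) => ->; eexists.
  exists d; apply/funext => i; rewrite pu; congr (t _).
  by elim: i {pu} => // i IH; rewrite ud IH mkseqS.
exists (mkseq d); split=> //; split=> // i; rewrite mkseqS.
by case: (d i); [right|left].
Qed.

Lemma langLP (t : tree bool) :
  langL t <-> exists d, infinitely_often (fun i => t (mkseq d i)) true.
Proof.
split=> [[p /is_pathP[d ->]]|[d id]]; first by exists d.
by exists (fun i => t (mkseq d i)) => //; apply/is_pathP; exists d.
Qed.

Lemma io_shift (S : Type) (p : nat -> S) k s :
  infinitely_often (fun i => p (k + i)) s <-> infinitely_often p s.
Proof.
split=> h N.
  have [i Ni pi] := h N; exists (k + i) => //.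
  exact: leq_trans Ni (leq_addl _ _).
have [i Ni pi] := h (k + N); have ki := leq_trans (leq_addr N k) Ni.
by exists (i - k); [rewrite leq_subRL|rewrite subnKC].
Qed.

Lemma mkseq_add (T : Type) (d : nat -> T) m i :
  mkseq d (m + i) = mkseq d m ++ mkseq (fun j => d (m + j)) i.
Proof.
elim: i => [|i IH]; first by rewrite addn0 cats0.
by rewrite addnS !mkseqS IH rcons_cat.
Qed.

Lemma mkseq_prefix (T : Type) (d : nat -> T) i u v :
  mkseq d i = u ++ v -> u = mkseq d (size u).
Proof.
move=> E; have ui : size u <= i.
  by rewrite -(size_mkseq d i) E size_cat leq_addr.
have := congr1 (take (size u)) E; rewrite take_size_cat // -(subnKC ui).
by rewrite mkseq_add take_size_cat ?size_mkseq.
Qed.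

Lemma subtree_cat (S : finType) (t : tree S) u v :
  subtree (subtree t u) v = subtree t (u ++ v).
Proof. by apply/funext => w; rewrite /subtree catA. Qed.

Lemma subtree_root (S : finType) (t : tree S) u : subtree t u [::] = t u.
Proof. by rewrite /subtree cats0. Qed.

Lemma rcons_nseq (T : Type) i (x : T) : rcons (nseq i x) x = nseq i.+1 x.
Proof. by elim: i => //= i ->. Qed.

Lemma mkseq_false i : mkseq (fun=> false) i = nseq i false.
Proof. by elim: i => // i IH; rewrite mkseqS IH rcons_nseq. Qed.

Lemma langL_subtree (t : tree bool) d m :
  infinitely_often (fun i => t (mkseq d i)) true ->
  langL (subtree t (mkseq d m)).
Proof.
move=> h; apply/langLP; exists (fun j => d (m + j)).
move/(io_shift (fun i => t (mkseq d i)) m): h; congr (infinitely_often _ _).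
by apply/funext => i; rewrite /subtree mkseq_add.
Qed.

Lemma address_cons k s : address (k :: s) = nseq k false ++ true :: address s.
Proof. by rewrite /address /= -catA. Qed.

(** The address is what is read up to and including the [k]-th letter r. *)
Lemma count_address (k : nat) (u : seq bool) : k <= count id u ->
  exists s v, size s = k /\ u = address s ++ v.
Proof.
elim: u k => [|b u IH] [|k] //=; try by exists [::]; eexists.
case: b => /=; rewrite ?add1n ?add0n.
  move/IH => [s [v [sk ->]]]; exists (0 :: s), v.
  by rewrite address_cons /= sk.
move/IH => [[|i s] [v [//= [sk] ->]]]; exists (i.+1 :: s), v.
by rewrite !address_cons /= sk.
Qed.

(* The first component of a state compares the current node with the guessed
   address: [Some true] on it (before or after its end), [Some false]
   lexicographically smaller, [None] no condition left to check.  The second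
   one counts the letters r read so far, up to n.  The third one is, before the
   n-th r, the parity of the current block of l's on the guessed address and,
   after it, the label of the parent node. *)
Section Automaton.
Variable n : nat.

Definition stateL : Type := (option bool * 'I_n.+1 * bool)%type.
HB.instance Definition _ := Finite.on stateL.

Definition st (m : option bool) (j : nat) (b : bool) : stateL :=
  (m, inord j, b).
Definition free : stateL := st None 0 false.
Definition on := st (Some true).
Definition less := st (Some false).

(** Before the [n]-th r, a node on the guess either goes left, flipping the parity and making the
    right child smaller, or turns right and frees the left child; the last turn requires odd parity.
    Past the end, [on] guesses one branch and frees the other child, while [less] follows both
    children. *)
Definition transL : {set stateL * bool * stateL * stateL} :=
  [set x : stateL * bool * stateL * stateL | let: (q, s, ql, qr) := x in
    match q with
    | (None, _, _) => (ql == free) && (qr == free)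
    | (Some false, j, b) =>
        if j < n then (ql == less j false) && (qr == less j.+1 false)
        else (ql == less n s) && (qr == less n s)
    | (Some true, j, b) =>
        if j < n then
          (ql == on j (~~ b)) && (qr == less j.+1 false) ||
          [&& ql == free, qr == on j.+1 false & (j.+1 == n) ==> b]
        else
          (ql == on n s) && (qr == free) || (ql == free) && (qr == on n s)
    end].

(** The clauses say: only finitely many 1's on a branch below a smaller address; infinitely many on
    the guessed branch; no postponing forever of a right turn on the guess. *)
Definition tableL : {set {set stateL}} :=
  [set Q : {set stateL} | [&& less n true \notin Q,
    (on n false \in Q) ==> (on n true \in Q) &
    [forall q in Q, ~~ ((q.1.1 == Some true) && (q.1.2 < n))]]].

Definition autL : muller_automaton bool :=
  MullerAutomaton transL (on 0 false) tableL.

Definition accepting_path (p : nat -> stateL) :=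
  [/\ ~ infinitely_often p (less n true),
    infinitely_often p (on n false) -> infinitely_often p (on n true) &
    forall j b, j < n -> ~ infinitely_often p (on j b)].

Lemma in_inf_states (p : nat -> stateL) q :
  reflect (infinitely_often p q) (q \in @inf_states _ autL p).
Proof. by rewrite inE; exact: asboolP. Qed.

Lemma tableLP (p : nat -> stateL) :
  @inf_states _ autL p \in mtable autL <-> accepting_path p.
Proof.
rewrite inE; split.
  case/and3P => /in_inf_states h1 /implyP h2 /forallP h3; split=> //.
    by move=> /in_inf_states/h2/in_inf_states.
  move=> j b jn /in_inf_states h; move: (h3 (on j b)).
  by rewrite h /= inordK ?jn // ltnS ltnW.
case=> h1 h2 h3; apply/and3P; split.
- by apply/in_inf_states.
- by apply/implyP => /in_inf_states/h2/in_inf_states.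
- apply/forallP => -[[m j] b]; apply/implyP => /in_inf_states h.
  apply/negP => /= /andP[/eqP mE jn]; apply: (h3 j b jn).
  by move: h; rewrite mE /on /st inord_val.
Qed.

Definition locally_run (t : tree bool) (rho : tree stateL) :=
  forall u, (rho u, t u, rho (rcons u false), rho (rcons u true)) \in transL.

(** The root state is left free, so that accepting runs can be restricted to subtrees and glued
    together. *)
Definition good (t : tree bool) (rho : tree stateL) :=
  locally_run t rho /\ forall d, accepting_path (fun i => rho (mkseq d i)).

Lemma autLP t : accepted_language autL t <->
  exists2 rho, good t rho & rho [::] = on 0 false.
Proof.
split=> [[rho [r0 rr] ar]|[rho [rr ar] r0]]; exists rho => //; first split=> //.
  by move=> d; apply: (tableLP _).1; apply: ar; apply/is_pathP; exists d.
move=> p H; have [d pE] := (is_pathP _ _).1 H; rewrite pE.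
apply: (tableLP _).2; exact: ar.
Qed.

Lemma accepting_path_shift p k :
  accepting_path (fun i => p (k + i)) <-> accepting_path p.
Proof.
have E := io_shift p k; split=> -[h1 h2 h3]; split.
- by move/(E _).2.
- by move/(E _).2/h2/(E _).1.
- by move=> j b jn /(E _).2; exact: h3.
- by move/(E _).1.
- by move/(E _).1/h2/(E _).2.
- by move=> j b jn /(E _).1; exact: h3.
Qed.

Lemma good_subtree t rho u : good t rho -> good (subtree t u) (subtree rho u).
Proof.
case=> rr ar; split=> [v|d].
  by rewrite /subtree -!rcons_cat; exact: rr.
(* The branch [d] of the subtree is prolonged upwards by [u]; acceptance ignores this finite
   prefix. *)
pose e i := if i < size u then nth false u i else d (i - size u).
have eu : mkseq e (size u) = u.
  apply: (@eq_from_nth _ false); rewrite size_mkseq // => i iu.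
  by rewrite nth_mkseq // /e iu.
have := (accepting_path_shift _ (size u)).2 (ar e).
congr accepting_path; apply/funext => i; rewrite mkseq_add eu /subtree.
congr (rho (_ ++ _)); apply: eq_mkseq => j.
by rewrite /e ltnNge leq_addr /= addKn.
Qed.

Definition node (q : stateL) (rl rr : tree stateL) : tree stateL :=
  fun u => if u is b :: v then (if b then rr v else rl v) else q.

Lemma good_node t q rl rr :
  (q, t [::], rl [::], rr [::]) \in transL ->
  good (subtree t [:: false]) rl -> good (subtree t [:: true]) rr ->
  good t (node q rl rr).
Proof.
move=> h0 [hl al] [hr ar]; split.
  by case=> [//|[] u]; [exact: hr|exact: hl].
move=> d; apply/(accepting_path_shift _ 1).
have dE i : mkseq d (1 + i) = d 0 :: mkseq (fun j => d j.+1) i.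
  by rewrite mkseq_add.
case d0: (d 0); [have := ar (fun j => d j.+1)|have := al (fun j => d j.+1)];
  by congr accepting_path; apply/funext => i; rewrite dE d0.
Qed.

Lemma good_free t : good t (fun=> free).
Proof.
split=> [u|d]; first by rewrite inE /= !eqxx.
by split=> [h|h|j b jn h]; have [i _] := h 0.
Qed.

(** * From accepting runs to membership in the language *)

Lemma good_less_label t rho : good t rho -> rho [::] = less n false ->
  ~ langL t.
Proof.
case=> rr ar r0 /langLP[d td]; have [lt _ _] := ar d; apply: lt => N.
(* All states from here on are [less n _], and the flag at depth [i.+1] is the label at depth [i];
   infinitely many 1's would make [less n true] recur. *)
have rl i : exists b, rho (mkseq d i) = less n b.
  elim: i => [|i [b IH]]; first by exists false.
  have := rr (mkseq d i); rewrite inE IH /= inordK // ltnn.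
  by rewrite mkseqS; case: (d i) => /andP[/eqP hl /eqP hr]; eexists; eauto.
have [i Ni ti] := td N; exists i.+1; first exact: leqW.
have [b hb] := rl i.
have := rr (mkseq d i); rewrite inE hb /= inordK // ltnn ti mkseqS.
by case: (d i) => /andP[/eqP hl /eqP hr].
Qed.

Lemma good_less_sound t rho s j : good t rho -> j + size s = n ->
  rho [::] = less j false -> ~ langL (subtree t (address s)).
Proof.
elim: s t rho j => [|i s IH] t rho j g.
  by rewrite addn0 => -> r0; exact: good_less_label r0.
move=> jn; have jn' : j < n by rewrite -jn addnS ltnS leq_addr.
have jn1 : j < n.+1 by rewrite ltnW.
have {}jn : j.+1 + size s = n by rewrite addSnnS.
rewrite address_cons; elim: i t rho g => [|i IHi] t rho g r0;
  have := g.1 [::]; rewrite inE r0 /= inordK // jn' => /andP[/eqP hl /eqP hr].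
  rewrite -cat1s -subtree_cat.
  exact: (IH _ _ j.+1 (good_subtree [:: true] g)).
rewrite -[false :: _]cat1s -subtree_cat.
exact: (IHi _ _ (good_subtree [:: false] g)).
Qed.

Lemma good_on_label t rho : good t rho -> rho [::] = on n false -> langL t.
Proof.
case=> rr ar r0.
(* The guessed branch goes right exactly when the left child is [free]. *)
pose next u := rcons u (rho (rcons u false) == free).
pose u i := iter i next [::].
have ub : is_branch u.
  by split=> // i; rewrite /u iterS /next; case: (_ == _); [right|left].
have step v b : rho v = on n b -> rho (next v) = on n (t v).
  move=> hv; have := rr v; rewrite inE hv /= inordK // ltnn /next.
  case: (rho (rcons v false) =P free) => [->|_] /=; last first.
    by rewrite orbF => /andP[/eqP].
  by move/eqP.
have uon i : exists b, rho (u i) = on n b.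
  elim: i => [|i [b IH]]; first by exists false.
  by exists (t (u i)); exact: step IH.
have uS i : rho (u i.+1) = on n (t (u i)) by have [b /step] := uon i.
have [d dE] : exists d, (fun i => rho (u i)) = fun i => rho (mkseq d i).
  by apply/is_pathP; exists u.
have := ar d; rewrite -dE => -[_ h _].
exists (fun i => t (u i)); first by exists u.
suff : infinitely_often (fun i => rho (u i)) (on n true).
  move=> H N; have [[//|i] Ni] := H N.+1; rewrite uS => -[ti].
  by exists i.
(* If [on n true] stopped occurring, the branch would be in [on n false] from some depth on, and
   acceptance would bring [on n true] back. *)
apply: contrapT => H; apply: (H); apply: h.
have [N HN] : exists N, forall i, N <= i -> rho (u i) <> on n true.
  apply: contrapT => K; apply: H => N; apply: contrapT => L.
  by apply: K; exists N => i Ni ri; apply: L; exists i.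
move=> M; exists (maxn M N); first exact: leq_maxl.
have := HN _ (leq_maxr M N); have [b ->] := uon (maxn M N).
by case: b.
Qed.

(** Without a right turn the spine of l's would stay in the states [on j _] with alternating bit, so
    [on j false] would recur, against acceptance. *)
Lemma good_on_spine t rho j : good t rho -> j < n -> rho [::] = on j false ->
  exists i, [/\ forall i', i' < i ->
      rho (nseq i' false ++ [:: true]) = less j.+1 false,
    rho (nseq i false ++ [:: true]) = on j.+1 false & j.+1 = n -> odd i].
Proof.
move=> [rr ar] jn r0; apply: contrapT => H.
have P i : rho (nseq i false) = on j (odd i) /\
    forall i', i' < i -> rho (nseq i' false ++ [:: true]) = less j.+1 false.
  elim: i => [//|i [IH1 IH2]]; have := rr (nseq i false).
  rewrite inE IH1 /= inordK ?jn; last by rewrite ltnW.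
  rewrite -!cats1; case/orP => [/andP[/eqP hl /eqP hr]|/and3P[_ /eqP hr jo]].
    split; first by rewrite -[false :: _]rcons_nseq -cats1.
    by move=> i'; rewrite ltnS leq_eqVlt => /orP[/eqP->//|/IH2].
  case: H; exists i; split=> // jn'; move: jo; rewrite jn' eqxx; exact.
have [_ _ /(_ j false jn)] := ar (fun=> false); apply.
move=> N; exists N.*2; first by rewrite -addnn leq_addr.
by rewrite mkseq_false (P _).1 odd_double.
Qed.

(** Induction on the number [k] of blocks left. A smaller address either turns right earlier in the
    first block, hence enters a [less] state, or shares that block and is smaller in the rest. *)
Lemma good_on_sound k t rho j : good t rho -> j + k = n ->
  rho [::] = on j false ->
  exists a, [/\ size a = k, langL (subtree t (address a)),
    0 < k -> odd (last 0 a) &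
    forall b, size b = k -> wo_lt (elt k b) (elt k a) ->
      ~ langL (subtree t (address b))].
Proof.
elim: k t rho j => [|k IH] t rho j g jn r0.
  exists [::]; split=> //.
    by apply: good_on_label g _; rewrite r0 -jn addn0.
have jn' : j < n by rewrite -jn addnS ltnS leq_addr.
have [i [hless hon hodd]] := good_on_spine g jn' r0.
have jk : j.+1 + k = n by rewrite addSnnS.
have [a [sa La oa ma]] := IH _ _ _ (good_subtree _ g) jk
  (etrans (subtree_root _ _) hon).
have E i' s :
    nseq i' false ++ true :: address s =
    (nseq i' false ++ [:: true]) ++ address s.
  by rewrite -catA.
exists (i :: a); split.
- by rewrite /= sa.
- by rewrite address_cons E -subtree_cat.
- move=> _; case: a sa oa {La ma} => [|i' a] /= sa oa.
    by apply: hodd; rewrite -jk -sa addn0.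
  by apply: oa; rewrite -sa.
- move=> [//|i' b] [sb] /= h; rewrite address_cons E -subtree_cat.
  case: h => [/= ii|[/= -> ba]]; last exact: ma.
  apply: (good_less_sound (good_subtree _ g) (j := j.+1)).
    by rewrite sb.
  by rewrite subtree_root; exact: hless.
Qed.

(** * From membership in the language to accepting runs *)

Definition parent (u : seq bool) := take (size u).-1 u.

Lemma parent_rcons u b : parent (rcons u b) = u.
Proof. by rewrite /parent size_rcons -cats1 take_size_cat. Qed.

Lemma less_complete k t j : j + k = n ->
  (forall s, size s = k -> ~ langL (subtree t (address s))) ->
  exists2 rho, good t rho & rho [::] = less j false.
Proof.
move=> jn H.
(* The number of letters r still to be read; truncated subtraction keeps it at 0 afterwards. *)
pose rest u := k - count id u.
pose rho : tree stateL := fun u =>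
  less (n - rest u) [&& u != [::], rest (parent u) == 0 & t (parent u)].
exists rho; last by rewrite /rho /rest /= subn0 -jn addnK.
split=> [u|d].
  have rcons0 b : rcons u b != [::] by case: u.
  rewrite inE /rho /= inordK ?ltnS ?leq_subr // !parent_rcons !rcons0 /=.
  have -> : rest (rcons u false) = rest u.
    by rewrite /rest -cats1 count_cat /= !addn0.
  have -> : rest (rcons u true) = (rest u).-1.
    by rewrite /rest -cats1 count_cat /= addn0 addn1 subnS.
  have rn : rest u <= n.
    by rewrite /rest -jn (leq_trans (leq_subr _ _)) // leq_addl.
  case E : (rest u) => [|r] /=; first by rewrite subn0 ltnn !eqxx.
  rewrite ltn_subrL (leq_ltn_trans _ (_ : r < n)) -?E // E.
  by rewrite -subSn ?subSS ?eqxx // -E.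
split=> [h|h|j' b jn' h]; last first.
- by have [i _] := h 0.
- by have [i _] := h 0.
have flag i : rho (mkseq d i.+1) = less n true ->
    k <= count id (mkseq d i) /\ t (mkseq d i).
  by rewrite /rho mkseqS parent_rcons => -[_ /and3P[_ /eqP r0 ti]];
    rewrite -subn_eq0 -/(rest _) r0.
(* One raised flag shows that the branch passes through the end of an address [s] of [k] blocks;
   recurring flags then put the subtree there in L. *)
have [[//|i] _ /flag[/count_address[s [v [sk E]]] _]] := h 1.
apply: (H s sk).
rewrite (mkseq_prefix E).
apply: langL_subtree => N; have [[//|m] Nm /flag[_ tm]] := h N.+1.
by exists m.
Qed.

Lemma on_complete_label t : langL t ->
  exists2 rho, good t rho & rho [::] = on n false.
Proof.
case/langLP => d td.
pose rho : tree stateL := fun u =>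
  if u == mkseq d (size u) then on n ((u != [::]) && t (parent u)) else free.
exists rho => //; split=> [u|e].
  have rcons0 b : rcons u b != [::] by case: u.
  rewrite inE /rho !parent_rcons !rcons0 !size_rcons !mkseqS !eqseq_rcons.
  case: eqP => [_|_] /=; last by rewrite !eqxx.
  by rewrite inordK // ltnn; case: (d _); rewrite /= !eqxx // orbT.
(* A branch either is [d] itself, or leaves it and stays in [free] from then on. *)
have [ed|] := pselect (forall i, mkseq e i = mkseq d i).
  have rE i : rho (mkseq e i.+1) = on n (t (mkseq d i)).
    by rewrite /rho size_mkseq !ed eqxx mkseqS parent_rcons; case: (mkseq d i).
  split.
  - by move=> h; have [[//|i] _] := h 1; rewrite rE.
  - move=> _ N; have [i Ni ti] := td N; exists i.+1; first exact: leqW.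
    by rewrite rE ti.
  - move=> j b jn h; have [[//|i] _] := h 1; rewrite rE => -[/(congr1 val)].
    by rewrite /= !inordK // => [nj|]; [move: jn; rewrite nj ltnn|rewrite ltnW].
move=> /existsNP[m em].
have fr i : rho (mkseq e (m + i)) = free.
  rewrite /rho size_mkseq; case: eqP => // E; case: em.
  have := congr1 (take m) E; rewrite !mkseq_add.
  by rewrite !take_size_cat ?size_mkseq.
apply/(accepting_path_shift _ m).
by split=> [h|h|j b jn h]; have [i _] := h 0; rewrite fr.
Qed.

Lemma on_complete k t j a : j + k = n -> size a = k ->
  langL (subtree t (address a)) -> (0 < k -> odd (last 0 a)) ->
  (forall b, size b = k -> wo_lt (elt k b) (elt k a) ->
      ~ langL (subtree t (address b))) ->
  exists2 rho, good t rho & rho [::] = on j false.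
Proof.
elim: k t j a => [|k IH] t j a.
  rewrite addn0 => ->; case: a => // _; rewrite /= => Lt _ _.
  exact: on_complete_label.
case: a => // i a jn [sa] La /(_ isT) oa.
have jk : j.+1 + k = n by rewrite addSnnS.
have jn' : j < n by rewrite -jn addnS ltnS leq_addr.
have jn1 : j < n.+1 by rewrite ltnW.
(* In the last block the length must be odd. Writing [i + false] exposes the bit of the root state,
   which is then generalized to the parity [b] of the l's already read, for the induction on [i]. *)
have {oa} : if a is [::] then odd (i + false) else odd (last 0 a).
  by case: a oa {La sa} => //=; rewrite addn0.
move: (false) => b.
elim: i t b La => [|i IHi] t b.
  rewrite address_cons -[_ ++ _]/([:: true] ++ address a) -subtree_cat.
  move=> La oa ma.
  have [|b' sb' b'a|rho g r0] := IH _ j.+1 a jk sa La.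
  - by rewrite -sa; case: a oa {La ma sa}.
  - rewrite subtree_cat; have := ma (0 :: b'); rewrite address_cons; apply.
      by rewrite /= sb'.
    by right.
  exists (node (on j b) (fun=> free) rho) => //.
  apply: good_node => //; last exact: good_free.
  rewrite inE r0 /= inordK // jn' !eqxx /=.
  apply/implyP => /eqP jn2; case: a sa oa {La ma} => [|? ?] /=.
    by rewrite add0n; case: b.
  move=> sa; move: jk; rewrite jn2 -sa -{2}(addn0 n) => /eqP.
  by rewrite eqn_add2l.
rewrite address_cons.
rewrite -[_ ++ _]/([:: false] ++ (nseq i false ++ true :: address a)).
rewrite -subtree_cat -address_cons => La oa ma.
have [||rl gl rl0] := IHi (subtree t [:: false]) (~~ b) La.
- case: a oa {La ma sa IHi} => //.
  by case: b; rewrite /= ?addn1 ?addn0 /= ?negbK.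
- move=> [//|i' b'] [sb'] /= h; rewrite subtree_cat.
  have := ma (i'.+1 :: b'); rewrite !address_cons; apply.
    by rewrite /= sb'.
  by case: h => [/= h|[/= -> h]]; [left|right].
have [|rr gr rr0] := less_complete jk (t := subtree t [:: true]).
  move=> b' sb'; rewrite subtree_cat.
  have := ma (0 :: b'); rewrite address_cons; apply; first by rewrite /= sb'.
  by left.
exists (node (on j b) rl rr) => //; apply: good_node => //.
by rewrite inE rl0 rr0 /= inordK // jn' !eqxx.
Qed.

Lemma autL_correct : 0 < n -> accepted_language autL = langL_ n.
Proof.
move=> n0; apply/seteqP; split=> t.
  case/autLP => rho g /(good_on_sound g (add0n n))[a [sa La oa ma]].
  by apply/(langLE _ n0); exists a; split=> //; exact: oa.
case/(langLE _ n0) => a [sa La oa ma]; apply/autLP.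
exact: (on_complete (add0n n) sa La).
Qed.
End Automaton.

(** * Completeness *)

Lemma filter_forall_lt (T : Type) (F : set_system T) (P : nat -> set T) m :
  Filter F -> (forall j, F (P j)) -> F [set x | forall j, j < m -> P j x].
Proof.
move=> FF FP; elim: m => [|m IH]; first exact: filterE.
apply: filterS2 IH (FP m) => x IH Pm j.
by rewrite ltnS leq_eqVlt => /orP[/eqP->|/IH].
Qed.

Lemma near_prefix (S : choiceType)
    (x : prod_topology (fun _ : nat => discrete_topology S)) (m : nat) :
  \forall y \near x, forall j, j < m -> y j = x j.
Proof.
apply: (filter_forall_lt (F := nbhs x) (P := fun j y => y j = x j)).
exact: near_coord.
Qed.

Lemma eq_mkseq_lt (T : Type) (f g : nat -> T) m :
  (forall j, j < m -> f j = g j) -> mkseq f m = mkseq g m.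
Proof.
elim: m => // m IH h; rewrite !mkseqS h // IH // => j jm.
exact/h/leqW.
Qed.

Lemma mkseq_eq_lt (T : Type) (f g : nat -> T) m :
  mkseq f m = mkseq g m -> forall j, j < m -> f j = g j.
Proof.
by move=> h j jm; rewrite -(nth_mkseq (f 0) f jm) h nth_mkseq.
Qed.

(* The witness y interleaves a branch with a sequence of depths, the i-th one
   being at least i, at which the branch carries the letter 1. *)
Lemma analytic_langL : analytic langL.
Proof.
pose br (y : baire) j := y j.*2 != 0.
exists [set z : tree bool * baire | forall i,
    i <= z.2 i.*2.+1 /\ z.1 (mkseq (br z.2) (z.2 i.*2.+1))].
  apply: closed_near => -[t y] /existsNP[i nC].
  set m := y i.*2.+1 in nC; set u := mkseq (br y) m in nC.
  have nt := near_fst (Y := baire) y (near_coord (I := seq bool) t u).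
  (* This prefix covers the depth stored at index 2i+1 and the [m] directions stored at the even
     indices below 2m. *)
  have ny := near_snd (X := tree bool) t (near_prefix y (m.*2 + i.*2.+2)).
  apply: filterS2 nt ny => -[t' y'] /= tu yj /(_ i).
  have ym : y' i.*2.+1 = m by apply: yj; rewrite addnS ltnS leq_addl.
  have yu : mkseq (br y') m = u.
    apply: eq_mkseq_lt => j jm; rewrite /br yj //.
    by rewrite ltn_addr // ltn_double.
  by rewrite ym yu tu => /nC.
rewrite predeqE => t; rewrite langLP; split=> [[d td]|[y /= Cy]].
  have /choice[m mP] i : exists m, i <= m /\ t (mkseq d m).
    by have [m im tm] := td i; exists m.
  exists (fun k => if odd k then m k./2 else d k./2 : nat) => i /=.
  rewrite odd_double /= uphalf_double; have [im tm] := mP i; split=> //.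
  congr (is_true (t _)): tm; apply: eq_mkseq => j.
  by rewrite /br odd_double doubleK; case: (d j).
exists (br y) => N; have [Nm tm] := Cy N; by exists (y N.*2.+1).
Qed.

(** * Addresses and the branches they spell *)

Lemma address_cat s s' : address (s ++ s') = address s ++ address s'.
Proof. by rewrite /address map_cat flatten_cat. Qed.

Lemma size_address s : size s <= size (address s).
Proof.
elim: s => // k s IH; rewrite address_cons size_cat size_nseq /= addnS ltnS.
exact: leq_trans IH (leq_addl _ _).
Qed.

Lemma count_id_address s : count id (address s) = size s.
Proof.
by elim: s => // k s IH; rewrite address_cons count_cat count_nseq /= IH mul0n.
Qed.

Lemma nseq_sep_inj i i' w w' :
  nseq i false ++ true :: w = nseq i' false ++ true :: w' -> i = i' /\ w = w'.
Proof.
elim: i i' => [|i IH] [|i'] //=; first by case.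
by case=> /IH[-> ->].
Qed.

Lemma address_cat_nth s s' v v' : address s ++ v = address s' ++ v' ->
  forall k, k < size s -> k < size s' -> nth 0 s k = nth 0 s' k.
Proof.
elim: s s' => [|i s IH] [|i' s'] //.
rewrite !address_cons -!catA /= => /nseq_sep_inj[-> /IH h] [|k] //=.
exact: h.
Qed.

Lemma address_cat_inj s s' v v' : size s = size s' ->
  address s ++ v = address s' ++ v' -> s = s' /\ v = v'.
Proof.
move=> ss e; have ss' : s = s'.
  apply: (@eq_from_nth _ 0) => // k ks.
  by apply: (address_cat_nth e ks); rewrite -ss.
by split=> //; move: e; rewrite ss' => /eqP; rewrite eqseq_cat // eqxx => /eqP.
Qed.

(** Letter [i] can be read off the first [i.+1] blocks, because each block contributes at least its
    r. *)
Lemma address_branch (y : nat -> nat) :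
  exists d, forall k,
    mkseq d (size (address (mkseq y k))) = address (mkseq y k).
Proof.
have nthE k i : i < size (address (mkseq y k)) ->
    nth false (address (mkseq y i.+1)) i = nth false (address (mkseq y k)) i.
  have pre a b : i < size (address (mkseq y a)) ->
      nth false (address (mkseq y (a + b))) i =
      nth false (address (mkseq y a)) i.
    by move=> ia; rewrite mkseq_add address_cat nth_cat ia.
  move=> ik; rewrite -(pre _ k) ?[i.+1 + k]addnC ?pre //.
  by have := size_address (mkseq y i.+1); rewrite size_mkseq.
exists (fun i => nth false (address (mkseq y i.+1)) i) => k.
apply: (@eq_from_nth _ false); rewrite size_mkseq // => i ik.
by rewrite nth_mkseq // (nthE k).
Qed.

Lemma closed_seq (X Y : topologicalType) (C : set (X * Y)) (x : nat -> X)
    (y : nat -> Y) (a : X) (b : Y) : closed C -> (forall k, C (x k, y k)) ->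
  x @ \oo --> a -> y @ \oo --> b -> C (a, b).
Proof.
move=> cC Cxy xa yb; apply: contrapT => /(near_notin cC)[[A B] /= [aA bB] AB].
have : \forall k \near \oo, ~ C (x k, y k).
  apply: (@filterS2 nat \oo _ (x @^-1` A) (y @^-1` B)); [|exact: xa|exact: yb].
  by move=> k Ak Bk; exact: (AB (x k, y k)).
by case/filter_ex => k; apply; exact: Cxy.
Qed.

Lemma analytic_wadge_langL (Y : finType) (A : set (word Y)) :
  analytic A -> wadge_le A langL.
Proof.
case=> C cC ->.
(* The basic neighbourhood given by [s] and the prefix of [x] of the same length meets [C]. *)
pose meets (x : word Y) (s : seq nat) := exists z : word Y * baire,
  [/\ C z, mkseq z.1 (size s) = mkseq x (size s) & mkseq z.2 (size s) = s].
pose f (x : word Y) : tree bool := fun u =>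
  `[< exists2 s, u = address s & meets x s >].
have fE x u : f x u <-> exists2 s, u = address s & meets x s.
  by split=> [/asboolP|/asboolP].
exists f.
  apply: continuous_coord => x u.
  (* An address is at least as long as its list of blocks, so the label at [u] depends only on the
     first [size u] letters of [x]. *)
  apply: (@filterS _ _ (nbhs_filter x) _ _ _ (near_prefix x (size u))).
  move=> x' xx'.
  apply/asbool_equiv_eq; split=> -[s us [z [Cz z1 z2]]]; exists s => //;
    exists z; split=> //; rewrite z1; apply: eq_mkseq_lt => j js;
    have ju : j < size u by rewrite us (leq_trans js) // size_address.
  - by rewrite xx'.
  - by rewrite xx'.
rewrite predeqE => x; split=> [[y Cxy]|].
  apply/langLP; have [d dE] := address_branch y.
  exists d => N; exists (size (address (mkseq y N))).
    by have := size_address (mkseq y N); rewrite size_mkseq.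
  rewrite dE; apply/fE; exists (mkseq y N) => //.
  by exists (x, y); rewrite size_mkseq.
case/langLP => d fd.
(* A node labelled 1 strictly below another one ends in r, so each further 1 on the branch adds at
   least one block. *)
have long K : exists m s, [/\ mkseq d m = address s, meets x s & K <= size s].
  elim: K => [|K [m [s [ms _ Ks]]]].
    by have [m _ /fE[s]] := fd 0; exists m, s.
  have [[//|m'] mm' /fE[s' ms' xs']] := fd m.+1; exists m'.+1, s'; split=> //.
  have dm' : d m'.
    have : s' <> [::].
      by move=> h; move: ms'; rewrite h mkseqS; case: (mkseq _ _).
    case/lastP: s' ms' {xs'} => // s' k; rewrite mkseqS -[rcons s' k]cats1.
    rewrite address_cat address_cons -[true :: _]/[:: true] catA cats1.
    by move/rcons_inj => [].
  rewrite -count_id_address -ms' mkseqS -(subnKC (mm' : m <= m')) mkseq_add.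
  rewrite -cats1 !count_cat ms count_id_address subnKC // dm' /= addn0 addn1.
  by rewrite ltnS (leq_trans Ks) // leq_addr.
have /choice[m mP] K := long K; have /choice[s sP] K := mP K.
have /choice[z zP] K : exists z : word Y * baire,
  [/\ C z, mkseq z.1 (size (s K)) = mkseq x (size (s K))
    & mkseq z.2 (size (s K)) = s K].
  by have [_ h _] := sP K.
(* The addresses lie on one branch, so their lists of blocks agree wherever both are defined; [y] is
   their common limit, and the points [z K] of [C] converge to [(x, y)]. *)
have same K K' k : k < size (s K) -> k < size (s K') ->
    nth 0 (s K) k = nth 0 (s K') k.
  have [ms _ _] := sP K; have [ms' _ _] := sP K'.
  apply: (@address_cat_nth _ _ (mkseq (fun j => d (m K + j)) (m K'))
    (mkseq (fun j => d (m K' + j)) (m K))).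
  by rewrite -ms -ms' -!mkseq_add addnC.
have sK K : K <= size (s K) by have [] := sP K.
pose y : baire := fun k => nth 0 (s k.+1) k.
exists y.
apply: (@closed_seq _ _ C (fun K => (z K).1) (fun K => (z K).2)) => //.
- by move=> K; have [] := zP K; case: (z K).
- apply: (@cvg_coord _ _ ((fun K => (z K).1) @ \oo)) => i.
  apply: filterS (nbhs_infty_gt i) => K iK.
  have [_ h _] := zP K; apply: (mkseq_eq_lt h).
  exact: leq_trans iK (sK K).
- apply: (@cvg_coord _ _ ((fun K => (z K).2) @ \oo)) => i.
  apply: filterS (nbhs_infty_gt i) => K iK.
  have iK' := leq_trans iK (sK K).
  have [_ _ h] := zP K.
  by apply: (etrans (esym (nth_mkseq 0 (z K).2 iK'))); rewrite h; exact: same.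
Qed.

Lemma subtree_continuous (S : finType) u :
  continuous (fun t : tree S => subtree t u).
Proof.
apply: continuous_coord => t v; exact: (near_coord (I := seq bool) t (u ++ v)).
Qed.

(** Addresses of [n] blocks are prefix-free, so the trees [g s x] can be grafted there
    independently; all remaining nodes get label 0. *)
Lemma wadge_glue (X : topologicalType) n (g : seq nat -> X -> tree bool) :
  (forall s, continuous (g s)) ->
  exists2 f : X -> tree bool, continuous f &
    forall x s, size s = n -> subtree (f x) (address s) = g s x.
Proof.
move=> cg.
pose f (x : X) : tree bool := fun u =>
  `[< exists s v, [/\ size s = n, u = address s ++ v & g s x v] >].
have fE x s v : size s = n -> f x (address s ++ v) = g s x v.
  move=> sn; apply/asboolP/idP => [[s' [v' [sn' e]]]|gv].
    by have [-> ->] := address_cat_inj (etrans sn (esym sn')) e.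
  by exists s, v.
exists f; last by move=> x s sn; apply/funext => v; exact: fE.
apply: continuous_coord => x u.
have [[s [v [sn ->]]]|nu] :=
  pselect (exists s v, size s = n /\ u = address s ++ v).
  apply: filterS (continuous_near_coord (cg s) x v) => y.
  by rewrite !fE.
apply: filterE => y; apply/asbool_equiv_eq.
by split=> -[s [v [sn uE _]]]; case: nu; exists s, v.
Qed.

Lemma langL_hard n (Y : finType) (E : set (word Y)) : 0 < n ->
  D_analytic (wo_exp wo_omega n) E -> wadge_le E (langL_ n).
Proof.
move=> n0 [A [_ aA ->]].
have /choice[g gP] i : exists g : word Y -> tree bool,
    continuous g /\ forall x, A i x <-> langL (g x).
  have [g cg gE] := analytic_wadge_langL (aA i).
  by exists g; split=> // x; rewrite gE.
have [f cf fE] := @wadge_glue _ n (fun s => g (elt n s))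
  (fun s => (gP (elt n s)).1).
exists f => //; rewrite predeqE => x.
have AE s : size s = n -> A (elt n s) x <-> langL (subtree (f x) (address s)).
  by move=> sn; rewrite fE // (gP _).2.
rewrite /preimage /= langLE //; split.
  case=> i [Ai mi /(opposite_parity_seg _ n0) oi].
  exists (coords i); rewrite size_coords; split=> //.
    by apply/AE; rewrite ?size_coords ?coordsK.
  by move=> b sb; rewrite coordsK => /mi; rewrite -AE.
case=> a [sa La oa ma]; exists (elt n a); split.
- exact/AE.
- move=> j ja /= Aj; apply: (ma (coords j)); rewrite ?size_coords ?coordsK //.
  by apply/AE; rewrite ?size_coords ?coordsK.
- by apply/(opposite_parity_seg _ n0); rewrite eltK.
Qed.

Lemma langL_in_class n (X : topologicalType) (E : set X) : 0 < n ->
  wadge_le E (langL_ n) -> D_analytic (wo_exp wo_omega n) E.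
Proof.
move=> n0 [f cf ->].
pose below (i : wo_exp wo_omega n) s :=
  size s = n /\ (elt n s = i \/ wo_lt (elt n s) i).
pose A (i : wo_exp wo_omega n) : set X :=
  [set x | exists2 s, below i s & langL (subtree (f x) (address s))].
have Aelt s x : size s = n ->
    langL (subtree (f x) (address s)) -> A (elt n s) x.
  by move=> sn Ls; exists s => //; split=> //; left.
exists A; split.
- move=> i j ij x [s [sn si] Ls]; exists s => //; split=> //; right.
  by case: si => [->//|si]; exact: wo_trans ij.
(* Lists of coefficients are enumerated by their codes; a code of no list, or of one not below [i],
   contributes the empty set. *)
- move=> i; pose F k : set X := if unpickle k is Some s then
    (if `[< below i s >] then [set x | langL (subtree (f x) (address s))]
     else set0) else set0.
  have -> : A i = [set x | exists k, F k x].
    rewrite predeqE => x; split=> [[s si Ls]|[k]].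
      by exists (pickle s); rewrite /F pickleK asboolT.
    by rewrite /F; case: unpickle => // s; case: asboolP => // si Ls; exists s.
  apply: analytic_bigcup => k; rewrite /F.
  case: unpickle => [s|]; last exact: analytic_set0.
  case: asboolP => _; last exact: analytic_set0.
  apply: (@analytic_preimage _ _ (fun x => subtree (f x) (address s)))
    analytic_langL.
  by move=> x; exact: (continuous_comp (cf x) (@subtree_continuous _ _ (f x))).
- rewrite predeqE => x; rewrite /preimage /= langLE //; split.
    case=> a [sa La oa ma]; exists (elt n a); split; first exact: Aelt.
      move=> j ja [s [sn si] Ls]; apply: (ma s sn) Ls.
      by case: si => [->//|si]; exact: wo_trans ja.
    by apply/(opposite_parity_seg _ n0); rewrite eltK.
  case=> i [[s [sn si] Ls] mi /(opposite_parity_seg _ n0) oi].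
  (* Minimality of [i] forces the witnessing address to be that of [i] itself. *)
  case: si => [si|/mi]; last by case; exact: Aelt.
  exists s; split=> //; first by rewrite -(eltK sn) si.
  by move=> b sb; rewrite si => /mi nA Lb; apply: nA; exact: Aelt.
Qed.

Theorem theorem4p6 (n : nat) (hn : (1 <= n)%N) :
  D_analytic_complete (wo_exp wo_omega n) (langL_ n) /\
  exists M : muller_automaton bool, accepted_language M = langL_ n.
Proof.
split; last by exists (autL n); exact: autL_correct.
by move=> Y E; split; [exact: langL_hard|exact: langL_in_class].
Qed.
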